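(* Let $\mathcal{E}$ be a graph with no sinks and with no vertex that is simultaneously a source and an infinite emitter. Let $\mathsf{X}$ be the associated one-sided edge subshift of $\mathcal{E}$. Then $\mathcal{O}_{\mathsf{X}}\cong C^*(\mathcal{E})$.
   Context: A (directed) graph is $\mathcal{E}=(\mathcal{E}^0,\mathcal{E}^1,r,s)$ with range and source maps $r,s:\mathcal{E}^1\to\mathcal{E}^0$. A vertex $v$ is a sink if $s^{-1}(v)=\emptyset$, a source if $r^{-1}(v)=\emptyset$, and an infinite emitter if $s^{-1}(v)$ is infinite. The graph C*-algebra $C^*(\mathcal{E})$ is the universal C*-algebra generated by mutually orthogonal projections $\{q_v:v\in\mathcal{E}^0\}$ and partial isometries $\{t_e:e\in\mathcal{E}^1\}$ with mutually orthogonal ranges such that $t_e^*t_e=q_{r(e)}$, $t_et_e^*\le q_{s(e)}$, and $q_v=\sum_{s(e)=v}t_et_e^*$ whenever $0<|s^{-1}(v)|<\infty$. The one-sided edge subshift of $\mathcal{E}$ is the set $\mathsf{X}$ of all infinite paths, i.e. the set of all sequences over the alphabet $\mathscr{A}=\mathcal{E}^1$ containing none of the words $ef$ with $r(e)\ne s(f)$. For a subshift $\mathsf{X}$ over an alphabet $\mathscr{A}$, $\mathcal{L}_{\mathsf{X}}$ is the set of all finite words occurring in elements of $\mathsf{X}$, including the empty word $\omega$. For $\alpha,\beta\in\mathcal{L}_{\mathsf{X}}$ put $C(\alpha,\beta)=\{\beta x\in\mathsf{X}:\alpha x\in\mathsf{X}\}$. $\mathcal{B}$ is the (generalised, i.e.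 not necessarily containing $\mathsf{X}$) Boolean algebra of subsets of $\mathsf{X}$ generated (under finite unions, finite intersections and relative complements) by all $C(\alpha,\beta)$ with $\alpha,\beta\in\mathcal{L}_{\mathsf{X}}$ not both equal to $\omega$. $\mathcal{O}_{\mathsf{X}}$ is the universal C*-algebra generated by projections $\{p_A:A\in\mathcal{B}\}$ and partial isometries $\{s_a:a\in\mathscr{A}\}$ subject to: (i) $p_{A\cap B}=p_Ap_B$, $p_{A\cup B}=p_A+p_B-p_{A\cap B}$, $p_\emptyset=0$ for all $A,B\in\mathcal{B}$; (ii) $s_\beta s_\alpha^*s_\alpha s_\beta^*=p_{C(\alpha,\beta)}$ for all $\alpha,\beta\in\mathcal{L}_{\mathsf{X}}\setminus\{\omega\}$, where $s_\alpha=s_{\alpha_1}\cdots s_{\alpha_n}$ for $\alpha=\alpha_1\cdots\alpha_n$; (iii) $s_\alpha^*s_\alpha=p_{C(\alpha,\omega)}$ for all $\alpha\in\mathcal{L}_{\mathsf{X}}\setminus\{\omega\}$; (iv) $s_\beta s_\beta^*=p_{C(\omega,\beta)}$ for all $\beta\in\mathcal{L}_{\mathsf{X}}\setminus\{\omega\}$. *)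

(* Defs.v *)
From HB Require Import structures.
From mathcomp Require Import all_boot all_order all_algebra.
From mathcomp Require Import all_classical all_reals all_analysis.
From mathcomp.real_closed Require Import complex.

Set Implicit Arguments.
Unset Strict Implicit.
Unset Printing Implicit Defensive.

Import Order.TTheory GRing.Theory Num.Theory.
Import numFieldNormedType.Exports.

Local Open Scope classical_set_scope.
Local Open Scope ring_scope.
Local Open Scope complex_scope.

(* C*-algebras over R[i].  No unit is assumed, which is why the ring structures
   of MathComp are not used for the product. *)
Record cstarAlgebra (R : realType) := CstarAlgebra {
  cstar_sort :> completeNormedModType R[i];
  cmul : cstar_sort -> cstar_sort -> cstar_sort;
  adj : cstar_sort -> cstar_sort;
  cmulA : forall x y z, cmul x (cmul y z) = cmul (cmul x y) z;
  cmulDl : forall x y z, cmul (x + y) z = cmul x z + cmul y z;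
  cmulDr : forall x y z, cmul x (y + z) = cmul x y + cmul x z;
  cmulZl : forall (a : R[i]) x y, cmul (a *: x) y = a *: cmul x y;
  cmulZr : forall (a : R[i]) x y, cmul x (a *: y) = a *: cmul x y;
  adjK : forall x, adj (adj x) = x;
  adjD : forall x y, adj (x + y) = adj x + adj y;
  adjZ : forall (a : R[i]) x, adj (a *: x) = Num.conj a *: adj x;
  adjM : forall x y, adj (cmul x y) = cmul (adj y) (adj x);
  cmul_norm_le : forall x y, `|cmul x y| <= `|x| * `|y|;
  cstar_identity : forall x, `|cmul (adj x) x| = `|x| ^+ 2
}.

Arguments cmul {R c}.
Arguments adj {R c}.

Declare Scope cstar_scope.
Delimit Scope cstar_scope with CS.
Notation "x ⋅ y" := (cmul x y) (at level 40, left associativity) : cstar_scope.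
Notation "x ^⋆" := (adj x) (at level 2, format "x ^⋆") : cstar_scope.
Local Open Scope cstar_scope.

Section CstarNotions.
Context (R : realType).
Implicit Types A B : cstarAlgebra R.

Definition projection A (p : A) : Prop := p ⋅ p = p /\ p^⋆ = p.

Definition partial_isometry A (s : A) : Prop := s ⋅ s^⋆ ⋅ s = s.

(* The order of projections: p is a subprojection of q. *)
Definition proj_le A (p q : A) : Prop := p ⋅ q = p.

Definition star_hom A B (h : A -> B) : Prop :=
  [/\ linear h, forall x y, h (x ⋅ y) = h x ⋅ h y & forall x, h x^⋆ = (h x)^⋆].

Definition cstar_isomorphic A B : Prop :=
  exists h : A -> B, star_hom h /\ bijective h.

(* (A, g) is the universal C*-algebra generated by a family indexed by G
   subject to the relations rel.  Uniqueness of h amounts to the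
   C*-algebra A being generated by the family g. *)
Definition universal_cstar (G : Type)
    (rel : forall A : cstarAlgebra R, (G -> A) -> Prop)
    A (g : G -> A) : Prop :=
  rel A g /\
  forall B (f : G -> B), rel B f ->
    exists h : A -> B,
      [/\ star_hom h,
          forall i, h (g i) = f i
        & forall h' : A -> B,
            star_hom h' -> (forall i, h' (g i) = f i) -> h' =1 h].

End CstarNotions.

Record graph := Graph {
  vertex : Type;
  edge : Type;
  rng : edge -> vertex;
  src : edge -> vertex
}.

Arguments rng {g}.
Arguments src {g}.

Definition is_sink (E : graph) (v : vertex E) : Prop :=
  src @^-1` [set v] = set0.

Definition is_source (E : graph) (v : vertex E) : Prop :=
  rng @^-1` [set v] = set0.

Definition infinite_emitter (E : graph) (v : vertex E) : Prop :=
  infinite_set (src @^-1` [set v]).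

Section GraphAlgebra.
Context (R : realType) (E : graph).

Inductive graph_gen : Type :=
| gen_q of vertex E
| gen_t of edge E.

Definition graph_relations (A : cstarAlgebra R) (f : graph_gen -> A) : Prop :=
  let q v := f (gen_q v) in
  let t e := f (gen_t e) in
  (forall v, projection (q v)) /\
  (forall v w, v <> w -> q v ⋅ q w = 0) /\
  (forall e, partial_isometry (t e)) /\
  (forall e e', e <> e' -> (t e ⋅ (t e)^⋆) ⋅ (t e' ⋅ (t e')^⋆) = 0) /\
  (forall e, (t e)^⋆ ⋅ t e = q (rng e)) /\
  (forall e, proj_le (t e ⋅ (t e)^⋆) (q (src e))) /\
  (forall v, ~ is_sink v -> ~ infinite_emitter v ->
     q v = \sum_(e \in [set e : {classic edge E} | src e = v]) (t e ⋅ (t e)^⋆)).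

Definition is_graph_algebra (A : cstarAlgebra R) : Prop :=
  exists g : graph_gen -> A, universal_cstar graph_relations g.

End GraphAlgebra.

Arguments is_graph_algebra {R} E A.

Section Subshift.
Context (T : Type).
Implicit Types (X : set (nat -> T)) (w : seq T) (x : nat -> T).

(* The finite word of length n occurring in x at position k. *)
Definition factor x (k n : nat) : seq T := mkseq (fun i => x (k + i)%N) n.

Definition avoiding (F : set (seq T)) : set (nat -> T) :=
  [set x | forall k n, ~ F (factor x k n)].

Definition language X : set (seq T) :=
  [set w | w = [::] \/ exists x k, X x /\ w = factor x k (size w)].

(* The infinite sequence w x; the default value given to nth is the relevant
   letter of x. *)
Definition prepend w x : nat -> T := fun n => nth (x (n - size w)%N) w n.

Definition Cset X (alpha beta : seq T) : set (nat -> T) :=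
  [set prepend beta x | x in
    [set x | X (prepend beta x) /\ X (prepend alpha x)]].

Inductive calB X : set (nat -> T) -> Prop :=
| calB_C alpha beta : language X alpha -> language X beta ->
    ~ (alpha = [::] /\ beta = [::]) -> calB X (Cset X alpha beta)
| calB_set0 : calB X set0
| calB_setU U V : calB X U -> calB X V -> calB X (U `|` V)
| calB_setI U V : calB X U -> calB X V -> calB X (U `&` V)
| calB_setD U V : calB X U -> calB X V -> calB X (U `\` V).

Lemma nonemptyl (alpha beta : seq T) :
  alpha <> [::] -> ~ (alpha = [::] /\ beta = [::]).
Proof. by move=> h []. Qed.

Lemma nonemptyr (alpha beta : seq T) :
  beta <> [::] -> ~ (alpha = [::] /\ beta = [::]).
Proof. by move=> h []. Qed.

Lemma language_nil X : language X [::].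
Proof. by left. Qed.

End Subshift.

Section SubshiftAlgebra.
Context (R : realType) (T : Type) (X : set (nat -> T)).

Inductive subshift_gen : Type :=
| gen_p (U : set (nat -> T)) of calB X U
| gen_s of T.

(* s_{a_1} ... s_{a_n}; the value 0 at the empty word is never used, since A
   need not have a unit. *)
Definition word_prod (A : cstarAlgebra R) (s : T -> A) (w : seq T) : A :=
  if w is a :: w' then foldl (fun x b => x ⋅ s b) (s a) w' else 0.

Definition subshift_relations (A : cstarAlgebra R) (f : subshift_gen -> A)
    : Prop :=
  let p U (hU : calB X U) := f (gen_p hU) in
  let s := word_prod (fun a => f (gen_s a)) in
  (forall U (hU : calB X U), projection (p U hU)) /\
  (forall a, partial_isometry (f (gen_s a))) /\
  (forall U V (hU : calB X U) (hV : calB X V),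
     p _ (calB_setI hU hV) = p U hU ⋅ p V hV) /\
  (forall U V (hU : calB X U) (hV : calB X V),
     p _ (calB_setU hU hV) = p U hU + p V hV - p _ (calB_setI hU hV)) /\
  p _ (calB_set0 X) = 0 /\
  (forall alpha beta (La : language X alpha) (Lb : language X beta)
     (na : alpha <> [::]) (nb : beta <> [::]),
     s beta ⋅ (s alpha)^⋆ ⋅ s alpha ⋅ (s beta)^⋆
       = p _ (calB_C La Lb (nonemptyl na))) /\
  (forall alpha (La : language X alpha) (na : alpha <> [::]),
     (s alpha)^⋆ ⋅ s alpha = p _ (calB_C La (language_nil X) (nonemptyl na))) /\
  (forall beta (Lb : language X beta) (nb : beta <> [::]),
     s beta ⋅ (s beta)^⋆ = p _ (calB_C (language_nil X) Lb (nonemptyr nb))).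

Definition is_subshift_algebra (A : cstarAlgebra R) : Prop :=
  exists g : subshift_gen -> A, universal_cstar subshift_relations g.

End SubshiftAlgebra.

Arguments is_subshift_algebra {R T} X A.

Definition edge_subshift (E : graph) : set (nat -> edge E) :=
  avoiding [set w | exists e f : edge E, rng e <> src f /\ w = [:: e; f]].

Arguments edge_subshift E : clear implicits.

(* Main.v *)
Require Import Defs.
From mathcomp Require Import all_boot all_order all_algebra.
From mathcomp Require Import finmap.
From mathcomp Require Import all_classical all_reals all_analysis.

(** Both algebras are universal, so it is enough to find in each of them a
    family satisfying the relations of the other, and to check that the two
    resulting *-homomorphisms are inverse to each other on generators.

    From the subshift to the graph: put q_v = p_U with U the set of infinite
    paths starting at v, and t_e = s_e.  This needs U to belong to the Boolean
    algebra.  If v is the range of an edge e, then U = C(e, ω).  Otherwise v is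
    a source, hence not an infinite emitter, and U is a finite union of
    cylinders C(ω, e) (calB_paths_from).  The graph relations then follow from
    the way cylinders intersect (graph_family_relations).

    From the graph to the subshift: the cylinder of a finite path w should be
    sent to the range projection t_w t_w^⋆, or to q_v when w is the empty path
    at v, and the question is whether this extends consistently to the Boolean
    algebra generated by the cylinders.  The relation [represents U p] says that
    p is computed in the C*-algebra by some Boolean expression whose value on
    sets is U; consistency is represents_unique.  Its proof is a localisation.
    A Boolean expression involves finitely many paths; let N bound their
    lengths and let L list their edges.  The expression is constant on the
    cylinder of w when w has length at least N, and, for w of any length, on the
    part of that cylinder that leaves w by an edge outside L.  On the algebra
    side p acts there as 0 or as the identity, in accordance with U
    (represents_settled).  Starting from the cylinder of any path, finitely many
    extensions by edges of L reach such pieces (corner_induction), so two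
    projections representing the same set act in the same way on every range
    projection, and hence are equal.  The one point at which the algebra could
    disagree with the sets is an empty piece: since there are no sinks, a piece
    is empty only when L contains all the edges leaving the end of w, and then
    the relation q_v = Σ t_e t_e^⋆ makes the corresponding corner of the
    algebra vanish (path_proj_exhausted, decides_unique). *)

Set Implicit Arguments.
Unset Strict Implicit.
Unset Printing Implicit Defensive.

Import GRing.Theory.
Local Open Scope classical_set_scope.
Local Open Scope ring_scope.
Local Open Scope cstar_scope.

(** * Paths and cylinder sets *)

Section Paths.
Local Open Scope nat_scope.
Context (E : graph).
Implicit Types (v u : vertex E) (e : edge E) (w : seq (edge E))
  (x y : nat -> edge E).

Fixpoint is_path v w : Prop :=
  if w is e :: w' then src e = v /\ is_path (rng e) w' else True.

Definition path_end v w : vertex E := last v (map rng w).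

Definition paths_from v : set (nat -> edge E) :=
  [set x | edge_subshift E x /\ src (x 0) = v].

Definition tail x : nat -> edge E := fun n => x n.+1.

(** For nonempty w the vertex v is ignored, so the definition is meant for
    paths w that start at v. *)
Fixpoint cylinder v w : set (nat -> edge E) :=
  if w is e :: w' then [set x | x 0 = e /\ cylinder (rng e) w' (tail x)]
  else paths_from v.

Lemma edge_subshiftP x :
  edge_subshift E x <-> forall n, rng (x n) = src (x n.+1).
Proof.
split=> [Xx n|Xx k n [e [f [ef xef]]]].
  apply: contrapT => nx; apply: (Xx n 2); exists (x n), (x n.+1).
  split=> //; rewrite /Defs.factor /mkseq /=.
  by rewrite addn0 addn1.
have : size (Defs.factor x k n) = 2 by rewrite xef.
rewrite size_mkseq => n2; move: xef; rewrite n2 /Defs.factor /mkseq /=.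
by rewrite addn0 addn1 => -[xe xf]; apply: ef; rewrite -xe -xf.
Qed.

Lemma edge_subshift_tail x :
  edge_subshift E x <-> rng (x 0) = src (x 1%N) /\ edge_subshift E (tail x).
Proof.
rewrite !edge_subshiftP; split=> [Xx|[x01 Xx] [|n]//]; last exact: Xx.
by split=> [|n]; apply: Xx.
Qed.

Lemma paths_from_cons e x :
  x 0 = e -> paths_from (src e) x <-> paths_from (rng e) (tail x).
Proof.
move=> xe; rewrite /paths_from/= edge_subshift_tail xe.
by split=> [[[-> ?] _]|[? <-]].
Qed.

Lemma prepend_nil x : prepend [::] x = x.
Proof. by apply/funext => n; rewrite /prepend subn0 nth_nil. Qed.

(** Together with cylinderP, this presents the cylinder of w as w followed by
    the paths from the end of w; all the sets C(α, β) are computed from it. *)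
Lemma paths_from_prepend v w x :
  paths_from v (prepend w x) <-> is_path v w /\ paths_from (path_end v w) x.
Proof.
elim: w v => [|e w IH] v /=; first by rewrite prepend_nil; tauto.
split=> [Pv|[[<- Pw] Px]].
  have ev : src e = v by case: Pv.
  have /IH[Pw Px] : paths_from (rng e) (prepend w x).
    by rewrite -[prepend w x]/(tail (prepend (e :: w) x)) -paths_from_cons// ev.
  by [].
by rewrite paths_from_cons//; apply/IH.
Qed.

Lemma cylinder_prepend v w x :
  is_path v w -> paths_from (path_end v w) x -> cylinder v w (prepend w x).
Proof.
elim: w v => [|e w IH] v /=; first by rewrite prepend_nil.
by move=> [_ Pw] Px; split=> //; apply: IH.
Qed.

Lemma cylinderP v w y : is_path v w -> cylinder v w y ->
  exists2 x, paths_from (path_end v w) x & y = prepend w x.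
Proof.
elim: w v y => [|e w IH] v y /=; first by exists y; rewrite ?prepend_nil.
move=> [_ Pw] [ye /(IH _ _ Pw)[x Px yx]]; exists x => //.
by apply/funext => -[|n]; rewrite ?ye// -[y _]/(tail y n) yx.
Qed.

Lemma cylinder_sub v w : is_path v w -> cylinder v w `<=` paths_from v.
Proof.
move=> Pw y /(cylinderP Pw)[x Px ->]; exact/paths_from_prepend.
Qed.

Lemma cylinder_nth v w d x : cylinder v (w ++ d) x ->
  forall i, i < size w -> x i = nth (x i) w i.
Proof.
elim: w v x => [|e w IH] v x //= [xe wx] [|i] //= iw.
by rewrite -[LHS]/(tail x i) (IH _ _ wx).
Qed.

Lemma cylinder_prefix v w d : is_path v (w ++ d) ->
  cylinder v (w ++ d) `<=` cylinder v w.
Proof.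
elim: w v => [|e w IH] v /=; first exact: cylinder_sub.
by move=> [_ Pw] x [xe wx]; split=> //; apply: IH wx.
Qed.

Lemma paths_from_disjoint u v x : paths_from u x -> paths_from v x -> u = v.
Proof. by move=> [_ <-] [_ <-]. Qed.

Lemma path_end_rcons v w e : path_end v (rcons w e) = rng e.
Proof. by rewrite /path_end map_rcons last_rcons. Qed.

Lemma is_path_cat v w w' :
  is_path v (w ++ w') <-> is_path v w /\ is_path (path_end v w) w'.
Proof.
elim: w v => [|f w IH] v /=; first by tauto.
by have := IH (rng f); rewrite /path_end /=; tauto.
Qed.

Lemma is_path_rcons v w e :
  is_path v (rcons w e) <-> is_path v w /\ src e = path_end v w.
Proof. by rewrite -cats1 is_path_cat /=; tauto. Qed.

Lemma is_path_language v w : is_path v w -> forall x,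
  paths_from (path_end v w) x -> language (edge_subshift E) w.
Proof.
move=> Pw x Px; right; exists (prepend w x), 0; split.
  by case: (proj2 (paths_from_prepend v w x) (conj Pw Px)).
apply: (@eq_from_nth _ (x 0)) => [|i iw]; first by rewrite size_mkseq.
by rewrite nth_mkseq// /prepend add0n (set_nth_default (x 0)).
Qed.

Lemma factor_is_path v w x :
  paths_from v x -> w = Defs.factor x 0 (size w) -> is_path v w.
Proof.
move=> Px wx.
have := proj1 (paths_from_prepend v w (fun n => x (size w + n)%N)).
suff -> : prepend w (fun n => x (size w + n)%N) = x.
  by case/(_ Px).
apply/funext => n; rewrite /prepend.
have [nw|nw] := ltnP n (size w); last by rewrite nth_default// subnKC.
by move: (x _) => d; rewrite (congr1 (nth d ^~ n) wx) nth_mkseq.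
Qed.

(** The converse, is_path_language, needs an infinite path to continue the word;
    this is where the absence of sinks enters the description of the words. *)
Lemma language_path e w :
  language (edge_subshift E) (e :: w) -> is_path (src e) (e :: w).
Proof.
case=> // -[x [k [Xx ew]]].
apply: (@factor_is_path _ _ (fun n => x (k + n)%N)); last exact: ew.
split; last by rewrite addn0; case: ew => ->; rewrite addn0.
by apply/edge_subshiftP => n; rewrite addnS; move/edge_subshiftP: Xx; apply.
Qed.

Lemma edge_subshift_prepend e w x : is_path (src e) (e :: w) ->
  edge_subshift E (prepend (e :: w) x) <->
  paths_from (path_end (src e) (e :: w)) x.
Proof.
move=> Pw; have := paths_from_prepend (src e) (e :: w) x.
by rewrite /paths_from/=; tauto.
Qed.

Lemma Cset_range e w : is_path (src e) (e :: w) ->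
  Cset (edge_subshift E) (e :: w) [::] = paths_from (path_end (src e) (e :: w)).
Proof.
move=> Pw; apply/seteqP; split=> [_ [x [_ /edge_subshift_prepend Px] <-]|x Px].
  by rewrite prepend_nil; apply: Px.
exists x; rewrite ?prepend_nil//; split; last exact/edge_subshift_prepend.
by rewrite prepend_nil; case: Px.
Qed.

Lemma Cset_cylinder e w : is_path (src e) (e :: w) ->
  Cset (edge_subshift E) [::] (e :: w) = cylinder (src e) (e :: w).
Proof.
move=> Pw; apply/seteqP; split=> [_ [x [/edge_subshift_prepend Px _] <-]|].
  by apply: cylinder_prepend => //; exact: Px.
move=> _ /(cylinderP Pw)[x Px ->]; exists x => //; split.
  exact/edge_subshift_prepend.
by rewrite prepend_nil; case: Px.
Qed.

Lemma Cset_same_range e w f w' :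
    is_path (src e) (e :: w) -> is_path (src f) (f :: w') ->
    path_end (src e) (e :: w) = path_end (src f) (f :: w') ->
  Cset (edge_subshift E) (e :: w) (f :: w') = cylinder (src f) (f :: w').
Proof.
move=> Pw Pw' ww'; apply/seteqP; split.
  move=> _ [x [/edge_subshift_prepend Px _] <-].
  by apply: cylinder_prepend => //; exact: Px.
move=> _ /(cylinderP Pw')[x Px ->]; exists x => //; split.
  exact/edge_subshift_prepend.
by apply/edge_subshift_prepend; rewrite ?ww'.
Qed.

Lemma Cset_other_range e w f w' :
    is_path (src e) (e :: w) -> is_path (src f) (f :: w') ->
    path_end (src e) (e :: w) <> path_end (src f) (f :: w') ->
  Cset (edge_subshift E) (e :: w) (f :: w') = set0.
Proof.
move=> Pw Pw' ww'; rewrite -subset0 => y [x [Xf Xe] yx]; apply: ww'.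
by apply: (@paths_from_disjoint _ _ x); apply/edge_subshift_prepend.
Qed.

Context (no_sinks : forall v, ~ is_sink v).

(** Without sinks an infinite path is obtained by choosing an edge out of every
    vertex and following these choices. *)
Lemma paths_from_nonempty v : exists x, paths_from v x.
Proof.
have /choice[out outP] : forall u, exists e, src e = u.
  move=> u; apply: contrapT => nu; apply: (no_sinks (v := u)).
  by rewrite /is_sink -subset0 => e eu; apply: nu; exists e.
exists (fun n => out (iter n (fun u => rng (out u)) v)); split=> /=.
  by apply/edge_subshiftP => n; rewrite outP.
exact: outP.
Qed.

End Paths.

(** * Computing in a C*-algebra *)

Section Cstar.
Context (R : realType) (A : cstarAlgebra R).
Implicit Types a b c p : A.

Lemma cmul0l a : 0 ⋅ a = 0.
Proof. by apply: (addIr (0 ⋅ a)); rewrite -cmulDl !add0r. Qed.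

Lemma cmul0r a : a ⋅ 0 = 0.
Proof. by apply: (addIr (a ⋅ 0)); rewrite -cmulDr !add0r. Qed.

Lemma cmulBl a b c : (a - b) ⋅ c = a ⋅ c - b ⋅ c.
Proof. by apply: (addIr (b ⋅ c)); rewrite -cmulDl !subrK. Qed.

Lemma cmulBr a b c : a ⋅ (b - c) = a ⋅ b - a ⋅ c.
Proof. by apply: (addIr (a ⋅ c)); rewrite -cmulDr !subrK. Qed.

Lemma cmul_suml (I : Type) (s : seq I) (F : I -> A) a :
  (\sum_(i <- s) F i) ⋅ a = \sum_(i <- s) F i ⋅ a.
Proof.
by elim: s => [|i s IH]; rewrite ?big_nil ?cmul0l// !big_cons cmulDl IH.
Qed.

Lemma adj0 : (0 : A)^⋆ = 0.
Proof. by apply: (addIr (0 : A)^⋆); rewrite -adjD !add0r. Qed.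

Lemma adjB a b : (a - b)^⋆ = a^⋆ - b^⋆.
Proof. by apply: (addIr b^⋆); rewrite -adjD !subrK. Qed.

Lemma word_prod_cons (T : Type) (s : T -> A) e f w :
  word_prod s (e :: f :: w) = s e ⋅ word_prod s (f :: w).
Proof.
rewrite /=; elim: w (s f) => [//|d w IH] b /=.
by rewrite -IH cmulA.
Qed.

End Cstar.

Section StarHom.
Context (R : realType) (A B : cstarAlgebra R) (h : A -> B) (hh : star_hom h).

Lemma star_homM a b : h (a ⋅ b) = h a ⋅ h b. Proof. by case: hh. Qed.

Lemma star_hom_adj a : h a^⋆ = (h a)^⋆. Proof. by case: hh. Qed.

Lemma star_homD a b : h (a + b) = h a + h b.
Proof. by case: hh => lh _ _; rewrite -[a]scale1r lh !scale1r. Qed.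

Lemma star_hom0 : h 0 = 0.
Proof. by apply: (addIr (h 0)); rewrite -star_homD !add0r. Qed.

Lemma star_homB a b : h (a - b) = h a - h b.
Proof. by apply: (addIr (h b)); rewrite -star_homD !subrK. Qed.

End StarHom.

Lemma star_hom_comp (R : realType) (A B C : cstarAlgebra R)
    (h : A -> B) (k : B -> C) :
  star_hom h -> star_hom k -> star_hom (k \o h).
Proof.
move=> [lh Mh ah] [lk Mk ak]; split=> [c a b|a b|a] /=.
- by rewrite lh lk.
- by rewrite Mh Mk.
- by rewrite ah ak.
Qed.

(** * Range projections of paths *)

Section GraphFamily.
Context (R : realType) (E : graph) (A : cstarAlgebra R).
Implicit Types (v u : vertex E) (e f : edge E) (w : seq (edge E)).

(** t_w t_w^⋆ for a nonempty path w, and q_v for the empty path at v.  The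
    recursion from the first edge serves the empty path as well, although the
    algebra has no unit to be its t_w. *)
Fixpoint path_proj (g : graph_gen E -> A) v w : A :=
  if w is e :: w' then g (gen_t e) ⋅ path_proj g (rng e) w' ⋅ (g (gen_t e))^⋆
  else g (gen_q v).

Context (g : graph_gen E -> A) (hg : graph_relations g).

Local Notation q v := (g (gen_q v)).
Local Notation t e := (g (gen_t e)).
Local Notation P := (path_proj g).

Lemma vertex_idem v : q v ⋅ q v = q v.
Proof. by case: hg => /(_ v)[]. Qed.

Lemma vertex_adj v : (q v)^⋆ = q v.
Proof. by case: hg => /(_ v)[]. Qed.

Lemma vertex_orth u v : u <> v -> q u ⋅ q v = 0.
Proof. by move=> uv; case: hg => _ [/(_ u v uv)]. Qed.

Lemma edge_iso e : t e ⋅ (t e)^⋆ ⋅ t e = t e.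
Proof. by case: hg => _ [_ [/(_ e)]]. Qed.

Lemma edge_range e : (t e)^⋆ ⋅ t e = q (rng e).
Proof. by case: hg => _ [_ [_ [_ [/(_ e)]]]]. Qed.

Lemma edge_vertex e : t e ⋅ q (rng e) = t e.
Proof. by rewrite -edge_range cmulA edge_iso. Qed.

Lemma vertex_edge e : q (src e) ⋅ t e = t e.
Proof.
case: hg => _ [_ [_ [_ [_ [/(_ e)/(congr1 (@adj _ _))]]]]].
rewrite !adjM adjK vertex_adj => qtt _.
by rewrite -[in LHS]edge_iso cmulA qtt edge_iso.
Qed.

Lemma edge_orth e f : e <> f -> (t e)^⋆ ⋅ t f = 0.
Proof.
move=> nef; case: hg => _ [_ [_ [/(_ e f nef) ef _]]].
rewrite -(edge_iso e) -(edge_iso f) !adjM adjK !cmulA.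
have -> : (t e)^⋆ ⋅ t e ⋅ (t e)^⋆ ⋅ t f ⋅ (t f)^⋆ ⋅ t f =
    (t e)^⋆ ⋅ (t e ⋅ (t e)^⋆ ⋅ (t f ⋅ (t f)^⋆)) ⋅ t f by rewrite !cmulA.
by rewrite ef cmul0r cmul0l.
Qed.

Lemma path_proj_adj v w : (P v w)^⋆ = P v w.
Proof.
elim: w v => [|e w IH] v /=; first exact: vertex_adj.
by rewrite !adjM adjK IH cmulA.
Qed.

Lemma vertex_path v w : is_path v w -> q v ⋅ P v w = P v w.
Proof.
case: w => [|e w] /=; first by rewrite vertex_idem.
by case=> <- _; rewrite !cmulA vertex_edge.
Qed.

Lemma path_vertex v w : is_path v w -> P v w ⋅ q v = P v w.
Proof.
move=> /vertex_path/(congr1 (@adj _ _)).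
by rewrite adjM vertex_adj path_proj_adj.
Qed.

Lemma edge_sandwich e a b :
  t e ⋅ a ⋅ (t e)^⋆ ⋅ (t e ⋅ b ⋅ (t e)^⋆) =
  t e ⋅ (a ⋅ (q (rng e) ⋅ b)) ⋅ (t e)^⋆.
Proof. by rewrite -edge_range !cmulA. Qed.

(** Two paths are nested or diverge, and the cylinders and the range projections
    reflect this in the same way.  The case where a properly extends w is left
    undecided: neither the cylinder of a nor its complement need contain that
    of w. *)
Lemma path_proj_trichotomy u a v w : is_path u a -> is_path v w ->
  [\/ cylinder v w `<=` cylinder u a /\ P u a ⋅ P v w = P v w,
      cylinder v w `&` cylinder u a = set0 /\ P u a ⋅ P v w = 0
    | u = v /\ exists e d, a = w ++ e :: d].
Proof.
elim: a u v w => [|e a IH] u v w.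
  move=> _ Pw; have [->|uv] := pselect (u = v).
    by apply: Or31; split; [exact: cylinder_sub|exact: vertex_path].
  apply: Or32; split.
    rewrite -subset0 => x [/(cylinder_sub Pw) vx ux]; apply: uv.
    exact: paths_from_disjoint ux vx.
  by rewrite -(vertex_path Pw) cmulA vertex_orth// cmul0l.
case: w => [|f w].
  move=> Pa _; have [<-|uv] := pselect (u = v).
    by apply: Or33; split=> //; exists e, a.
  apply: Or32; split.
    rewrite -subset0 => x [vx /(cylinder_sub Pa) ux]; apply: uv.
    exact: paths_from_disjoint ux vx.
  by rewrite -(path_vertex Pa) -cmulA vertex_orth// cmul0r.
move=> /= [eu Pa] [fv Pw]; have [ef|ef] := pselect (e = f); last first.
  apply: Or32; split.
    by rewrite -subset0 => x [[xf _] [xe _]]; apply: ef; rewrite -xe.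
  by rewrite !cmulA -[_ ⋅ _ ⋅ t f]cmulA edge_orth// cmul0r !cmul0l.
case: f / ef fv Pw => ev Pw.
have [[wa aw]|[wa aw]|[_ [f [d ->]]]] := IH _ _ _ Pa Pw.
- apply: Or31; split; first by move=> x /= [x0 /wa].
  by rewrite edge_sandwich vertex_path// aw.
- apply: Or32; split.
    rewrite -subset0 => x [[_ wx] [_ ax]].
    by have : set0 (tail x) by rewrite -wa.
  by rewrite edge_sandwich vertex_path// aw cmul0r cmul0l.
- by apply: Or33; split; [rewrite -eu -ev|exists f, d].
Qed.

Lemma path_proj_idem v w : is_path v w -> P v w ⋅ P v w = P v w.
Proof.
elim: w v => [|e w IH] v /=; first by rewrite vertex_idem.
by move=> [_ Pw]; rewrite edge_sandwich vertex_path// IH.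
Qed.

Lemma path_proj_prefix v w d : is_path v (w ++ d) ->
  P v w ⋅ P v (w ++ d) = P v (w ++ d).
Proof.
elim: w v => [|e w IH] v /=; first exact: vertex_path.
by move=> [_ Pw]; rewrite edge_sandwich vertex_path// IH.
Qed.

Lemma path_proj_extension v w d : is_path v (w ++ d) ->
  P v (w ++ d) ⋅ P v w = P v (w ++ d).
Proof.
move=> /path_proj_prefix/(congr1 (@adj _ _)).
by rewrite adjM !path_proj_adj.
Qed.

Lemma path_proj_diverge v w e f : e <> f ->
    is_path v (rcons w e) -> is_path v (rcons w f) ->
  P v (rcons w e) ⋅ P v (rcons w f) = 0.
Proof.
move=> ef; elim: w v => [|d w IH] v /=.
  by rewrite !cmulA -[_ ⋅ _ ⋅ t f]cmulA edge_orth// cmul0r !cmul0l.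
move=> [_ Pe] [_ Pf].
by rewrite edge_sandwich vertex_path// IH// cmul0r cmul0l.
Qed.

Lemma path_proj_commute u a v w : is_path u a -> is_path v w ->
  P u a ⋅ P v w = P v w ⋅ P u a.
Proof.
move=> Pa Pw; rewrite -[RHS]adjK adjM !path_proj_adj.
suff : (P u a ⋅ P v w)^⋆ = P u a ⋅ P v w by [].
have [[_ aw]|[_ aw]|[uv [e [d aE]]]] := path_proj_trichotomy Pa Pw.
- by rewrite aw path_proj_adj.
- by rewrite aw adj0.
- rewrite adjM !path_proj_adj; subst u a.
  by rewrite path_proj_prefix// path_proj_extension.
Qed.

Local Notation word := (word_prod (fun e => t e)).

Lemma word_range e w : is_path (src e) (e :: w) ->
  (word (e :: w))^⋆ ⋅ word (e :: w) = q (path_end (src e) (e :: w)).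
Proof.
elim: w e => [|f w IH] e; first by move=> _; exact: edge_range.
move=> [_ [fe Pw]]; rewrite word_prod_cons adjM -cmulA.
rewrite [(t e)^⋆ ⋅ _]cmulA edge_range -fe.
have -> : q (src f) ⋅ word (f :: w) = word (f :: w).
  case: w {IH Pw} => [|d w]; first exact: vertex_edge.
  by rewrite word_prod_cons cmulA vertex_edge.
by rewrite IH.
Qed.

Lemma word_vertex e w : is_path (src e) (e :: w) ->
  word (e :: w) ⋅ q (path_end (src e) (e :: w)) = word (e :: w).
Proof.
elim: w e => [|f w IH] e; first by move=> _; exact: edge_vertex.
move=> [_ [fe Pw]]; rewrite word_prod_cons -cmulA.
by congr (_ ⋅ _); exact: IH.
Qed.

Lemma word_source e w : is_path (src e) (e :: w) ->
  word (e :: w) ⋅ (word (e :: w))^⋆ = P (src e) (e :: w).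
Proof.
elim: w e => [|f w IH] e; first by move=> _ /=; rewrite edge_vertex.
move=> [_ [fe Pw]]; rewrite word_prod_cons adjM cmulA.
by rewrite -[_ ⋅ _ ⋅ (word _)^⋆]cmulA IH.
Qed.

(** The sum relation at the end of w, transported to its start: if M contains
    all the edges leaving the end of w, then the end is not an infinite emitter
    and the range projection of w is the sum of those of its one-edge
    extensions. *)
Lemma path_proj_exhausted v w (M : seq {classic edge E}) a :
    ~ is_sink (path_end v w) -> is_path v w ->
    (forall e : edge E, src e = path_end v w -> e \in M) ->
    (forall e : edge E, is_path v (rcons w e) -> P v (rcons w e) ⋅ a = 0) ->
  P v w ⋅ a = 0.
Proof.
elim: w v a => [|e w IH] v a /=.
  move=> nsv _ vM Pa.
  have finv : finite_set [set e : {classic edge E} | src e = v].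
    apply: (@sub_finite_set _ _ [set` M]); last exact: finite_seq.
    by move=> e /vM.
  case: hg => _ [_ [_ [_ [_ [_ /(_ v nsv)->]]]]]; last by apply.
  rewrite fsbig_finite// cmul_suml big1_seq// => e.
  rewrite in_fset_set// inE /= => ve.
  by have := Pa e (conj ve I); rewrite /= edge_vertex.
move=> nsv [ev Pw] wM Pa; rewrite -!cmulA IH ?cmul0r// => f Pf.
rewrite -(vertex_path Pf) -edge_range -!cmulA.
have := Pa f (conj ev Pf); rewrite -!cmulA => ->; exact: cmul0r.
Qed.

End GraphFamily.

(** * Representing the Boolean algebra of cylinders *)

Section Represents.
Context (R : realType) (E : graph) (A : cstarAlgebra R).
Context (g : graph_gen E -> A).
Implicit Types (v u : vertex E) (e f : edge E) (w : seq (edge E))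
  (U V : set (nat -> edge E)) (M L : seq {classic edge E}) (a p r z : A).

Local Notation P := (path_proj g).

(** A relation rather than a function, because the same set is the value of
    many Boolean expressions. *)
Inductive represents : set (nat -> edge E) -> A -> Prop :=
| represents_cylinder v w : is_path v w -> represents (cylinder v w) (P v w)
| represents_set0 : represents set0 0
| represents_setU U V p r : represents U p -> represents V r ->
    represents (U `|` V) (p + r - p ⋅ r)
| represents_setI U V p r : represents U p -> represents V r ->
    represents (U `&` V) (p ⋅ r)
| represents_setD U V p r : represents U p -> represents V r ->
    represents (U `\` V) (p - p ⋅ r).

Context (hg : graph_relations g).

Lemma represents_centralizer z :
    (forall v w, is_path v w -> z ⋅ P v w = P v w ⋅ z) ->
  forall U p, represents U p -> z ⋅ p = p ⋅ z.
Proof.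
move=> zP U p; elim=> {U p} [v w /zP//||U V p r _ zp _ zr
  |U V p r _ zp _ zr|U V p r _ zp _ zr].
- by rewrite cmul0l cmul0r.
- by rewrite cmulBr cmulBl cmulDr cmulDl cmulA zp -!cmulA zr.
- by rewrite cmulA zp -!cmulA zr.
- by rewrite cmulBr cmulBl cmulA zp -!cmulA zr.
Qed.

(** Commutation comes before the projection property, which products and unions
    inherit only from commuting projections. *)
Lemma represents_commute U V p r :
  represents U p -> represents V r -> p ⋅ r = r ⋅ p.
Proof.
move=> Up Vr; apply: represents_centralizer Vr => v w Pw.
apply: esym; apply: represents_centralizer Up => u a Pa.
exact: path_proj_commute.
Qed.

Lemma represents_adj U p : represents U p -> p^⋆ = p.
Proof.
elim=> {U p} [v w _||U V p r Up pE Vr rE|U V p r Up pE Vr rE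
  |U V p r Up pE Vr rE].
- exact: path_proj_adj.
- exact: adj0.
- by rewrite adjB adjD adjM pE rE (represents_commute Up Vr).
- by rewrite adjM pE rE (represents_commute Up Vr).
- by rewrite adjB adjM pE rE (represents_commute Up Vr).
Qed.

Lemma represents_idem U p : represents U p -> p ⋅ p = p.
Proof.
elim=> {U p} [v w Pw||U V p r Up pp Vr rr|U V p r Up pp Vr rr
  |U V p r Up pp Vr rr].
- exact: path_proj_idem.
- exact: cmul0l.
- have pu : p ⋅ (p + r - p ⋅ r) = p by rewrite cmulBr cmulDr cmulA pp addrK.
  have ru : r ⋅ (p + r - p ⋅ r) = r.
    rewrite cmulBr cmulDr cmulA rr -(represents_commute Up Vr) -cmulA rr.
    by rewrite addrAC subrr add0r.
  by rewrite cmulBl cmulDl -cmulA ru pu.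
- by rewrite -cmulA [r ⋅ _]cmulA -(represents_commute Up Vr) -cmulA rr cmulA pp.
- have prp : p ⋅ r ⋅ p = p ⋅ r.
    by rewrite -cmulA -(represents_commute Up Vr) cmulA pp.
  by rewrite cmulBl !cmulBr !cmulA prp pp -[p ⋅ r ⋅ r]cmulA rr subrr subr0.
Qed.

Lemma represents_projection U p : represents U p -> projection p.
Proof.
by move=> Up; split; [exact: represents_idem Up|exact: represents_adj Up].
Qed.

(** The algebraic counterpart of the paths that begin with w and continue by an
    edge outside M: the right ideal of the elements supported there.  With
    elements in place of a difference of projections, enlarging M visibly
    shrinks the corner. *)
Definition corner v w M a : Prop :=
  P v w ⋅ a = a /\
  forall e, (e : {classic edge E}) \in M -> is_path v (rcons w e) ->
    P v (rcons w e) ⋅ a = 0.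

(** U and p are constant, with the same value b, on the piece of the cylinder of
    w that leaves w by an edge outside M.  On an empty piece b is arbitrary. *)
Definition decides v w M U p : Prop := exists b : bool,
  (forall x, cylinder v w x -> (x (size w) : {classic edge E}) \notin M ->
     U x <-> b) /\
  (forall a, corner v w M a -> p ⋅ a = if b then a else 0).

Definition settled (N : nat) L U p : Prop :=
  forall v w M, is_path v w -> (N <= size w)%N \/ {subset L <= M} ->
  decides v w M U p.

(** By the trichotomy, only a proper prefix of w can fail to decide the cylinder
    of w, and then the next edge of w belongs to M. *)
Lemma settled_cylinder u w : is_path u w ->
  settled (size w) (w : seq {classic edge E}) (cylinder u w) (P u w).
Proof.
move=> Pw v d M Pd hM.
have [[dw wd]|[dw wd]|[uv [e [c wE]]]] := path_proj_trichotomy hg Pw Pd.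
- exists true; split=> [x /dw wx _|a [da _]]; first by [].
  by rewrite -da cmulA wd.
- exists false; split=> [x dx _|a [da _]]; last first.
    by rewrite -da cmulA wd cmul0l.
  by split=> // wx; have : set0 x by rewrite -dw.
subst v; have eM : (e : {classic edge E}) \in M.
  case: hM => [|wM]; first by rewrite wE size_cat/= addnS leqNgt ltnS leq_addr.
  by apply: wM; rewrite wE mem_cat mem_head orbT.
have wE' : w = rcons d e ++ c by rewrite cat_rcons.
have Pde : is_path u (rcons d e) by move: Pw; rewrite wE' => /is_path_cat[].
exists false; split=> [x dx xM|a [_ /(_ e eM Pde) ea]].
  split=> // wx; move: wx xM; rewrite wE' => /cylinder_nth/(_ (size d)).
  by rewrite size_rcons ltnS leqnn nth_rcons ltnn eqxx => ->//; rewrite eM.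
rewrite wE' -(path_proj_extension hg (d := c)) -?wE'//.
by rewrite -cmulA ea cmul0r.
Qed.

Lemma decidesU v w M U V p r : decides v w M U p -> decides v w M V r ->
  decides v w M (U `|` V) (p + r - p ⋅ r).
Proof.
move=> [b [bU bp]] [c [cV cr]]; exists (b || c); split=> [x wx xM|a ca].
  have [tT fF] : true /\ ~ false by [].
  have := bU x wx xM; have := cV x wx xM.
  by case: b {bU bp}; case: c {cV cr} => /=; rewrite /setU/=; tauto.
rewrite cmulBl cmulDl -cmulA bp// cr//; case: c {cV cr} => /=.
  by rewrite bp// orbT addrAC subrr add0r.
by rewrite cmul0r subr0 addr0 orbF.
Qed.

Lemma decidesI v w M U V p r : decides v w M U p -> decides v w M V r ->
  decides v w M (U `&` V) (p ⋅ r).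
Proof.
move=> [b [bU bp]] [c [cV cr]]; exists (b && c); split=> [x wx xM|a ca].
  have [tT fF] : true /\ ~ false by [].
  have := bU x wx xM; have := cV x wx xM.
  by case: b {bU bp}; case: c {cV cr} => /=; rewrite /setI/=; tauto.
rewrite -cmulA cr//; case: c {cV cr}; last by rewrite cmul0r andbF.
by rewrite bp// andbT.
Qed.

Lemma decidesD v w M U V p r : decides v w M U p -> decides v w M V r ->
  decides v w M (U `\` V) (p - p ⋅ r).
Proof.
move=> [b [bU bp]] [c [cV cr]]; exists (b && ~~ c); split=> [x wx xM|a ca].
  have [tT fF] : true /\ ~ false by [].
  have := bU x wx xM; have := cV x wx xM.
  by case: b {bU bp}; case: c {cV cr} => /=; rewrite /setD/=; tauto.
rewrite cmulBl -cmulA bp// cr//; case: c {cV cr}.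
  by rewrite bp// andbF subrr.
by rewrite cmul0r andbT subr0.
Qed.

(** Being settled passes to Boolean combinations because both N and L may be
    enlarged. *)
Lemma represents_settled U p : represents U p ->
  exists N L, settled N L U p.
Proof.
have join N L N' L' U1 U2 p1 p2 U3 p3 :
    settled N L U1 p1 -> settled N' L' U2 p2 ->
    (forall v w M, decides v w M U1 p1 -> decides v w M U2 p2 ->
       decides v w M U3 p3) ->
  exists N L, settled N L U3 p3.
  move=> s1 s2 s3; exists (maxn N N'), (L ++ L') => v w M Pw.
  rewrite geq_max => hM; apply: s3; [apply: s1|apply: s2] => //.
    case: hM => [/andP[]|sM]; [by left|].
    by right=> e eL; apply: sM; rewrite mem_cat eL.
  case: hM => [/andP[]|sM]; [by left|].
  by right=> e eL; apply: sM; rewrite mem_cat eL orbT.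
elim=> {U p} [v w Pw||U V p r _ [N [L s1]] _ [N' [L' s2]]
  |U V p r _ [N [L s1]] _ [N' [L' s2]]|U V p r _ [N [L s1]] _ [N' [L' s2]]].
- by exists (size w), w; exact: settled_cylinder.
- exists 0, [::] => v w M _ _; exists false; split=> [//|a _].
  exact: cmul0l.
- by apply: join s1 s2 _ => v w M; exact: decidesU.
- by apply: join s1 s2 _ => v w M; exact: decidesI.
- by apply: join s1 s2 _ => v w M; exact: decidesD.
Qed.

Lemma represents_faithful U p z : represents U p ->
    (forall v w, is_path v w -> z ⋅ P v w = 0) ->
  z ⋅ p = 0.
Proof.
move=> Up zP; elim: Up => {U p} [v w /zP//||U V p r _ zp _ zr
  |U V p r _ zp _ zr|U V p r _ zp _ zr].
- exact: cmul0r.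
- by rewrite cmulBr cmulDr cmulA zp zr cmul0l addr0 subr0.
- by rewrite cmulA zp cmul0l.
- by rewrite cmulBr cmulA zp cmul0l subr0.
Qed.

(** Subtracting from a its components on the extensions of w by the edges of M,
    one at a time, leaves an element of the corner. *)
Lemma corner_induction v w M (Q : A -> Prop) : is_path v w ->
    (forall a b, Q a -> Q b -> Q (a + b)) ->
    (forall e a, is_path v (rcons w e) -> P v (rcons w e) ⋅ a = a -> Q a) ->
    (forall a, corner v w M a -> Q a) ->
  forall a, P v w ⋅ a = a -> Q a.
Proof.
move=> Pw QD Qe; elim: M => [|e M IH] QM a wa; first by apply: QM.
apply: IH wa => {}a [wa Ma].
have [Pwe|nPwe] := pselect (is_path v (rcons w e)); last first.
  apply: QM; split=> // f; rewrite inE => /predU1P[->//|]; exact: Ma.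
rewrite -[a](subrK (P v (rcons w e) ⋅ a)); apply: QD; last first.
  by apply: (Qe e) => //; rewrite cmulA path_proj_idem.
apply: QM; split=> [|f].
  by rewrite cmulBr wa cmulA -cats1 path_proj_prefix ?cats1.
rewrite inE cmulBr cmulA => fM Pwf; have [fe|fe] := pselect (f = e).
  by rewrite fe path_proj_idem// subrr.
rewrite path_proj_diverge// cmul0l subr0; apply: Ma => //.
by case/predU1P : fM.
Qed.

Context (no_sinks : forall v, ~ is_sink v).

(** A nonempty piece determines the value of U on it, hence both actions.  If
    the piece is empty, U may be taken to be everything or nothing on it, but then
    every edge leaving the end of w is in M and the corner is zero. *)
Lemma decides_unique v w M U p r : is_path v w ->
    decides v w M U p -> decides v w M U r ->
  forall a, corner v w M a -> p ⋅ a = r ⋅ a.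
Proof.
move=> Pw [b [bU bp]] [c [cU cr]] a ca; rewrite bp// cr//.
have [[x wx xM]|nx] := pselect (exists2 x, cylinder v w x &
    (x (size w) : {classic edge E}) \notin M).
  have := bU x wx xM; have := cU x wx xM.
  by case: b {bU bp}; case: c {cU cr} => // -[? ?] [? ?]; exfalso; auto.
suff -> : a = 0 by case: b {bU bp}; case: c {cU cr}.
have wM e : src e = path_end v w -> (e : {classic edge E}) \in M.
  move=> ew; apply: contrapT => /negP eM; apply: nx.
  have Pwe : is_path v (rcons w e) by apply/is_path_rcons.
  have [x ex] := paths_from_nonempty no_sinks (rng e).
  have wex : cylinder v (rcons w e) (prepend (rcons w e) x).
    by apply: cylinder_prepend => //; rewrite path_end_rcons.
  exists (prepend (rcons w e) x).
    by move: wex; rewrite -cats1; apply: cylinder_prefix; rewrite cats1.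
  have /cylinder_nth/(_ (size w)) :
      cylinder v (rcons w e ++ [::]) (prepend (rcons w e) x) by rewrite cats0.
  rewrite size_rcons ltnS leqnn nth_rcons ltnn eqxx => -> //.
case: ca => wa Ma; rewrite -wa.
apply: (path_proj_exhausted hg (M := M)) => // e Pwe.
by apply: Ma => //; apply: wM; case/is_path_rcons: Pwe.
Qed.

(** Descending induction on the length of w shows that p and r act alike on the
    elements supported on w.  Hence (p - r) p = 0 = (p - r) r, and p = r since p
    and r are commuting idempotents. *)
Lemma represents_unique U p r : represents U p -> represents U r -> p = r.
Proof.
move=> Up Ur.
have [N [L sp]] := represents_settled Up.
have [N' [L' sr]] := represents_settled Ur.
have agree v w a : is_path v w -> P v w ⋅ a = a -> p ⋅ a = r ⋅ a.
  have [k] := ubnP (maxn N N' - size w); elim: k w a => // k IH w a kw Pw wa.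
  have [wN|wN] := leqP (maxn N N') (size w).
    apply: (@decides_unique v w [::] U) => //.
      by apply: sp => //; left; apply: leq_trans wN; rewrite leq_maxl.
    by apply: sr => //; left; apply: leq_trans wN; rewrite leq_maxr.
  apply: (@corner_induction v w (L ++ L') (fun a => p ⋅ a = r ⋅ a)) wa => //.
  - by move=> b c pb pc; rewrite !cmulDr pb pc.
  - move=> e b Pwe; apply: IH => //; rewrite size_rcons.
    by rewrite -ltnS (leq_trans _ kw)// ltnS ltn_sub2l.
  move=> b; apply: (@decides_unique v w _ U) => //.
    by apply: sp => //; right=> f fL; rewrite mem_cat fL.
  by apply: sr => //; right=> f fL; rewrite mem_cat fL orbT.
have pr0 v w : is_path v w -> (p - r) ⋅ P v w = 0.
  by move=> Pw; rewrite cmulBl (agree v w)// ?subrr// path_proj_idem.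
have /eqP := represents_faithful Up pr0.
have /eqP := represents_faithful Ur pr0.
rewrite !cmulBl !subr_eq0 (represents_idem Up) (represents_idem Ur).
by rewrite (represents_commute Up Ur) => /eqP -> /eqP.
Qed.

End Represents.

Section ImageOfRepresents.
Context (R : realType) (E : graph) (A B : cstarAlgebra R).

Lemma star_hom_path_proj (h : A -> B) (g : graph_gen E -> A) v w :
  star_hom h -> h (path_proj g v w) = path_proj (h \o g) v w.
Proof.
move=> hh; elim: w v => [//|e w IH] v /=.
by rewrite !(star_homM hh) (star_hom_adj hh) IH.
Qed.

(** Boolean expressions in the range projections are preserved by
    *-homomorphisms; with represents_graph_family this gives the image of
    set_proj in the subshift algebra. *)
Lemma star_hom_represents (h : A -> B) (g : graph_gen E -> A) U p :
  star_hom h -> represents g U p -> represents (h \o g) U (h p).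
Proof.
move=> hh; elim=> {U p} [v w Pw||U V p r _ Up _ Vr|U V p r _ Up _ Vr
  |U V p r _ Up _ Vr].
- rewrite star_hom_path_proj//; exact: represents_cylinder.
- rewrite (star_hom0 hh); exact: represents_set0.
- by rewrite (star_homB hh) (star_homD hh) (star_homM hh); apply: represents_setU.
- by rewrite (star_homM hh); apply: represents_setI.
- by rewrite (star_homB hh) (star_homM hh); apply: represents_setD.
Qed.

End ImageOfRepresents.

(** * The subshift family of a graph family *)

Section SubshiftFamily.
Context (R : realType) (E : graph) (A : cstarAlgebra R).
Context (g : graph_gen E -> A) (hg : graph_relations g).
Context (no_sinks : forall v : vertex E, ~ is_sink v).

Local Notation X := (edge_subshift E).

Lemma calB_represents U : calB X U -> exists p, represents g U p.
Proof.
elim=> {U} [a b La Lb ab||U V _ [p Up] _ [r Vr]|U V _ [p Up] _ [r Vr]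
  |U V _ [p Up] _ [r Vr]].
- case: a La ab => [|e a] La ab; case: b Lb ab => [|f b] Lb ab.
  + by case: ab.
  + rewrite Cset_cylinder; last exact: language_path.
    exists (path_proj g (src f) (f :: b)); apply: represents_cylinder.
    exact: language_path.
  + rewrite Cset_range; last exact: language_path.
    by eexists; apply: (@represents_cylinder _ _ _ g _ [::]).
  + have [ab'|ab'] :=
        pselect (path_end (src e) (e :: a) = path_end (src f) (f :: b)).
      rewrite Cset_same_range//; try exact: language_path.
      exists (path_proj g (src f) (f :: b)); apply: represents_cylinder.
      exact: language_path.
    rewrite Cset_other_range//; try exact: language_path.
    by exists 0; exact: represents_set0.
- by exists 0; exact: represents_set0.
- by eexists; apply: represents_setU Up Vr.
- by eexists; apply: represents_setI Up Vr.
- by eexists; apply: represents_setD Up Vr.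
Qed.

Definition set_proj (U : set (nat -> edge E)) : A := xget 0 (represents g U).

Lemma set_projE U p : represents g U p -> set_proj U = p.
Proof.
move=> Up; apply: (represents_unique hg no_sinks _ Up).
by apply: (@xgetPex _ 0 (represents g U)); exists p.
Qed.

Lemma set_projP U : calB X U -> represents g U (set_proj U).
Proof. by move=> /calB_represents[p Up]; rewrite (set_projE Up). Qed.

Definition subshift_family (i : subshift_gen X) : A :=
  match i with
  | gen_p U _ => set_proj U
  | gen_s e => g (gen_t e)
  end.

(** The Boolean relations hold by uniqueness of the represented projection.
    The others compare t_b t_a^⋆ t_a t_b^⋆ = t_b q_u t_b^⋆, with u the end of a:
    this is the range projection of b if b ends at u too, and 0 otherwise, like
    the set C(a, b). *)
Lemma subshift_family_relations : subshift_relations subshift_family.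
Proof.
split=> [U hU|]; first exact: represents_projection hg _ _ (set_projP hU).
split=> [e|]; first exact: edge_iso.
split=> [U V hU hV|].
  by apply: set_projE; apply: represents_setI; apply: set_projP.
split=> [U V hU hV|].
  rewrite /= (set_projE (represents_setI (set_projP hU) (set_projP hV))).
  by apply: set_projE; apply: represents_setU; apply: set_projP.
split; first exact/set_projE/represents_set0.
have word_setproj b : b <> [::] -> language X b ->
    let s := word_prod (fun e => g (gen_t e)) b in
    s ⋅ s^⋆ = set_proj (Cset X [::] b).
  case: b => // f b _ /language_path Pb /=.
  rewrite Cset_cylinder// -/(word_prod (fun e => g (gen_t e)) (f :: b)).
  rewrite word_source//; apply: esym.
  exact/set_projE/represents_cylinder.
split=> [a b La Lb na nb|].
  rewrite /subshift_family.
  case: a La na => // e a /language_path Pa _.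
  case: b Lb nb => // f b /language_path Pb _.
  rewrite -[_ ⋅ _^⋆ ⋅ _]cmulA word_range//.
  have [ab|ab] :=
      pselect (path_end (src e) (e :: a) = path_end (src f) (f :: b)).
    rewrite ab word_vertex// word_source// Cset_same_range//; apply: esym.
    exact/set_projE/represents_cylinder.
  rewrite Cset_other_range// -(word_vertex hg Pb) -[_ ⋅ _ ⋅ g _]cmulA.
  rewrite (vertex_orth hg) ?cmul0r ?cmul0l; last exact: nesym.
  by apply: esym; exact/set_projE/represents_set0.
split=> [a La na|b Lb nb]; last exact: word_setproj.
rewrite /subshift_family.
case: a La na => // e a /language_path Pa _.
rewrite word_range// Cset_range//; apply: esym; apply: set_projE.
exact: (@represents_cylinder _ _ _ g _ [::]).
Qed.

End SubshiftFamily.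

(** * The graph family of a subshift family *)

Section GraphFamilyOfSubshift.
Context (R : realType) (E : graph) (A : cstarAlgebra R).
Context (no_sinks : forall v : vertex E, ~ is_sink v).
Context (no_source_infinite_emitter :
  forall v : vertex E, ~ (is_source v /\ infinite_emitter v)).
Local Notation X := (edge_subshift E).
Context (f : subshift_gen X -> A) (hf : subshift_relations f).

Definition first_edge_in (s : seq {classic edge E}) : set (nat -> edge E) :=
  [set x | X x /\ (x 0%N : {classic edge E}) \in s].

Lemma first_edge_in_cons e s :
  first_edge_in (e :: s) = cylinder (src e) [:: e] `|` first_edge_in s.
Proof.
have eE x : cylinder (src e) [:: e] x <-> X x /\ x 0%N = e.
  split=> [/= [xe]|[Xx xe]]; first by rewrite -paths_from_cons// => -[].
  by split=> //=; rewrite -paths_from_cons//; split; rewrite ?xe.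
apply/seteqP; split=> x; rewrite /first_edge_in/setU/=.
  by rewrite inE => -[Xx /predU1P[xe|xs]]; [left; apply/eE|right].
rewrite inE; case=> [/eE[Xx ->]|[Xx xs]]; first by rewrite eqxx.
by split=> //; rewrite xs orbT.
Qed.

Lemma calB_cylinder e w : is_path (src e) (e :: w) ->
  calB X (cylinder (src e) (e :: w)).
Proof.
move=> Pw; rewrite -Cset_cylinder//; apply: calB_C; first exact: language_nil.
  have [x Px] := paths_from_nonempty no_sinks (path_end (src e) (e :: w)).
  exact: is_path_language Px.
by case.
Qed.

Lemma calB_first_edge_in s : calB X (first_edge_in s).
Proof.
elim: s => [|e s IH].
  rewrite (_ : first_edge_in _ = set0) -?subset0 => [|x []//].
  exact: calB_set0.
by rewrite first_edge_in_cons; apply: calB_setU => //; exact: calB_cylinder.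
Qed.

Lemma paths_from_first_edge_in v : finite_set (src @^-1` [set v]) ->
  paths_from v =
  first_edge_in (fset_set [set e : {classic edge E} | src e = v]).
Proof.
move=> vfin; apply/seteqP; split=> x; rewrite /first_edge_in/=.
  by move=> [Xx xv]; split=> //; rewrite in_fset_set//; exact: mem_set.
by move=> [Xx]; rewrite in_fset_set// => /set_mem.
Qed.

(** A vertex that receives an edge e carries C(e, ω).  A source has no such
    description, but it emits finitely many edges. *)
Lemma calB_paths_from v : calB X (paths_from v).
Proof.
have [[e <-]|nv] := pselect (exists e, rng e = v).
  rewrite -[rng e]/(path_end (src e) [:: e]) -Cset_range//.
  apply: calB_C; [|exact: language_nil|by case].
  have [x Px] := paths_from_nonempty no_sinks (path_end (src e) [:: e]).
  exact: is_path_language Px.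
have vfin : finite_set (src @^-1` [set v]).
  apply: contrapT => vinf; apply: (@no_source_infinite_emitter v); split=> //.
  by rewrite /is_source -subset0 => e ev; apply: nv; exists e.
by rewrite paths_from_first_edge_in//; exact: calB_first_edge_in.
Qed.

(** Extending the generators by 0 outside the Boolean algebra removes their
    dependence on a membership proof, so that they can be rewritten along
    equalities of sets. *)
Definition gen_proj (U : set (nat -> edge E)) : A :=
  if pselect (calB X U) is left hU then f (gen_p hU) else 0.

Lemma gen_projE U (hU : calB X U) : f (gen_p hU) = gen_proj U.
Proof.
rewrite /gen_proj; case: pselect => // hU'.
by rewrite (Prop_irrelevance hU hU').
Qed.

Lemma gen_proj_projection U : calB X U -> projection (gen_proj U).
Proof. by move=> hU; rewrite -(gen_projE hU); case: hf. Qed.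

Lemma gen_proj_set0 : gen_proj set0 = 0.
Proof. by rewrite -(gen_projE (calB_set0 X)); case: hf => _ [_ [_ [_ []]]]. Qed.

Lemma gen_proj_setI U V : calB X U -> calB X V ->
  gen_proj (U `&` V) = gen_proj U ⋅ gen_proj V.
Proof.
move=> hU hV; rewrite -(gen_projE (calB_setI hU hV)) -!gen_projE.
by case: hf => _ [_ []].
Qed.

Lemma gen_proj_setU U V : calB X U -> calB X V ->
  gen_proj (U `|` V) = gen_proj U + gen_proj V - gen_proj U ⋅ gen_proj V.
Proof.
move=> hU hV; rewrite -gen_proj_setI// -(gen_projE (calB_setU hU hV)).
by case: hf => _ [_ [_ [-> _]]]; rewrite !gen_projE.
Qed.

(** The relations mention no difference; U is the disjoint union of its
    difference and its intersection with V. *)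
Lemma gen_proj_setD U V : calB X U -> calB X V ->
  gen_proj (U `\` V) = gen_proj U - gen_proj U ⋅ gen_proj V.
Proof.
move=> hU hV; have hD := calB_setD hU hV; have hI := calB_setI hU hV.
have dI : (U `\` V) `&` (U `&` V) = set0.
  by rewrite -subset0 => x [[_ nVx] [_ Vx]]; exact: nVx.
have := gen_proj_setU hD hI.
rewrite -gen_proj_setI// dI gen_proj_set0 subr0 setUC setUIDK.
by rewrite gen_proj_setI// => /esym/(canRL (addrK _)).
Qed.

Definition graph_family (i : graph_gen E) : A :=
  match i with
  | gen_q v => gen_proj (paths_from v)
  | gen_t e => f (gen_s X e)
  end.

Local Notation t e := (f (gen_s X e)).

Lemma edge_source_gen_proj e :
  t e ⋅ (t e)^⋆ = gen_proj (cylinder (src e) [:: e]).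
Proof.
have Pe : is_path (src e) [:: e] by [].
have [x Px] := paths_from_nonempty no_sinks (path_end (src e) [:: e]).
have Le := is_path_language Pe Px.
have ne : [:: e] <> [::] by [].
case: hf => _ [_ [_ [_ [_ [_ [_ /(_ [:: e] Le ne)/= ->]]]]]].
by rewrite gen_projE Cset_cylinder.
Qed.

Lemma edge_range_gen_proj e : (t e)^⋆ ⋅ t e = gen_proj (paths_from (rng e)).
Proof.
have Pe : is_path (src e) [:: e] by [].
have [x Px] := paths_from_nonempty no_sinks (path_end (src e) [:: e]).
have Le := is_path_language Pe Px.
have ne : [:: e] <> [::] by [].
case: hf => _ [_ [_ [_ [_ [_ [/(_ [:: e] Le ne)/= -> _]]]]]].
by rewrite gen_projE Cset_range.
Qed.

Lemma sum_edge_source_gen_proj s : uniq s ->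
  gen_proj (first_edge_in s) = \sum_(e <- s) (t e ⋅ (t e)^⋆).
Proof.
elim: s => [_|e s IH /= /andP[es us]].
  rewrite big_nil (_ : first_edge_in _ = set0) ?gen_proj_set0//.
  by rewrite -subset0 => x [].
rewrite big_cons -IH// first_edge_in_cons edge_source_gen_proj.
have he : calB X (cylinder (src e) [:: e]) by exact: calB_cylinder.
have hs := calB_first_edge_in s.
rewrite gen_proj_setU// -gen_proj_setI// (_ : _ `&` _ = set0).
  by rewrite gen_proj_set0 subr0.
by rewrite -subset0 => x [[xe _] [_]]; rewrite xe (negPf es).
Qed.

Lemma graph_family_relations : graph_relations graph_family.
Proof.
have hv := calB_paths_from.
have he e : calB X (cylinder (src e) [:: e]) by exact: calB_cylinder.
split=> [v|]; first exact: gen_proj_projection.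
split=> [u v uv|].
  rewrite /= -gen_proj_setI// (_ : _ `&` _ = set0) ?gen_proj_set0//.
  by rewrite -subset0 => x [ux vx]; apply: uv; exact: paths_from_disjoint ux vx.
split=> [e|]; first by case: hf => _ [/(_ e)].
split=> [e e' ee'|].
  rewrite /= !edge_source_gen_proj -gen_proj_setI// (_ : _ `&` _ = set0).
    exact: gen_proj_set0.
  by rewrite -subset0 => x [[xe _] [xe' _]]; apply: ee'; rewrite -xe.
split=> [e|]; first exact: edge_range_gen_proj.
split=> [e|v _ /contrapT vfin].
  rewrite /proj_le /= edge_source_gen_proj -gen_proj_setI// setIidl//.
  exact: cylinder_sub.
rewrite /= fsbig_finite// -sum_edge_source_gen_proj ?fset_uniq//.
by rewrite -paths_from_first_edge_in.
Qed.

(** The projections attached to sets by the graph family are the original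
    generators, so the passage from the subshift to the graph and back is the
    identity. *)
Lemma represents_graph_family U p :
  represents graph_family U p -> calB X U /\ p = gen_proj U.
Proof.
elim=> {U p} [v w Pw||U V p r _ [hU ->] _ [hV ->]|U V p r _ [hU ->] _ [hV ->]
  |U V p r _ [hU ->] _ [hV ->]].
- case: w Pw => [_|e w]; first by split=> //; exact: calB_paths_from.
  move=> Pw; have [ev _] := Pw; subst v.
  have hw := calB_cylinder Pw; split=> //.
  rewrite -(word_source graph_family_relations Pw).
  have [x Px] := paths_from_nonempty no_sinks (path_end (src e) (e :: w)).
  have Le := is_path_language Pw Px.
  have ne : e :: w <> [::] by [].
  case: hf => _ [_ [_ [_ [_ [_ [_ /(_ (e :: w) Le ne)]]]]]].
  by rewrite gen_projE Cset_cylinder.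
- by rewrite gen_proj_set0; split=> //; exact: calB_set0.
- by rewrite gen_proj_setU//; split=> //; exact: calB_setU.
- by rewrite gen_proj_setI//; split=> //; exact: calB_setI.
- by rewrite gen_proj_setD//; split=> //; exact: calB_setD.
Qed.

End GraphFamilyOfSubshift.

Unset Implicit Arguments.

Theorem proposition4p1 (R : realType) (E : graph)
    (no_sinks : forall v : vertex E, ~ is_sink v)
    (no_source_infinite_emitter :
       forall v : vertex E, ~ (is_source v /\ infinite_emitter v))
    (O : cstarAlgebra R) (hO : is_subshift_algebra (edge_subshift E) O)
    (C : cstarAlgebra R) (hC : is_graph_algebra E C) :
  cstar_isomorphic O C.
Proof.
case: hO => gO [relO univO]; case: hC => gC [relC univC].
have relO' := graph_family_relations no_sinks no_source_infinite_emitter relO.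
have [h [hh hE _]] := univO C _ (subshift_family_relations relC no_sinks).
have [k [kh kE _]] := univC O _ relO'.
have kgC : k \o gC = graph_family gO by apply/funext => i; exact: kE.
have kh_gen i : k (h (gO i)) = gO i.
  rewrite hE; case: i => [U hU|e] /=; last by rewrite kE.
  have := star_hom_represents kh (set_projP relC no_sinks hU).
  rewrite kgC.
  move/(represents_graph_family no_sinks no_source_infinite_emitter relO).
  by case=> _ ->; rewrite (gen_projE gO hU).
have hk_gen i : h (k (gC i)) = gC i.
  rewrite kE; case: i => [v|e] /=; last by rewrite hE.
  have hv := calB_paths_from no_sinks no_source_infinite_emitter v.
  rewrite -(gen_projE gO hv) hE /=; apply: set_projE => //.
  exact: (@represents_cylinder _ _ _ gC v [::]).
exists h; split=> //; exists k => a.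
- have [id' [_ _ idU]] := univO O gO relO.
  rewrite -[LHS]/((k \o h) a) (idU (k \o h))//; last exact: star_hom_comp.
  by rewrite -(idU idfun).
- have [id' [_ _ idU]] := univC C gC relC.
  rewrite -[LHS]/((h \o k) a) (idU (h \o k))//; last exact: star_hom_comp.
  by rewrite -(idU idfun).
Qed.
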